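(* Let $V\subset\mathbb{R}^N$ be a bounded convex set and suppose the reservoir system $\dot{x}(t)=F(x(t),\omega\phi^t(m))$ is $V$-invariant. Suppose further that there exists a $\delta>0$ such that for any $w,v\in V$ and $z\in\omega(M)$ $$\frac{v^{\top}D_xF(w,z)v}{\|v\|^2}<-\delta,$$ where $D_xF(x,z)$ denotes the derivative of $F(x,z)$ with respect to $x$. Then the reservoir system is uniformly $V$-asymptotically stable with respect to $\{\omega\phi^t(m)\}_{m\in M}$, and hence admits a uniform $V$-generalised synchronisation $f_{(\omega,\mathcal{V},F)}\in C^0(M,V)$.
   Context: Setting. $\mathcal{V}$ is a smooth vector field on a smooth manifold $M$ with associated evolution operators $\{\phi^t\in\mathrm{Diff}^1(M)\mid t\in\mathbb{R}\}$ that form a group under composition, so that $\phi^{t_1+t_2}=\phi^{t_1}\phi^{t_2}$. The observation function $\omega\in C^0(M,\mathbb{R}^d)$ is continuous, and $F\in C^1(\mathbb{R}^N\times\mathbb{R}^d,\mathbb{R}^N)$ is Lipschitz continuous. Juxtaposition denotes composition, e.g. $\omega\phi^t(m)=\omega(\phi^t(m))$ and $f\phi^t(m)=f(\phi^t(m))$. The (continuous time) reservoir system is the ODE $\dot{x}(t)=F(x(t),\omega\phi^t(m))$, for $m\in M$. For $r\in\mathbb{R}^N$ and $m\in M$, $x^r_m(t)$ denotes its solution originating from the initial point $r$, i.e. $x^r_m(0)=r$. Definitions, for $V\subset\mathbb{R}^N$: - For a bounded function $z\in C^0(\mathbb{R},\mathbb{R}^d)$ and Lipschitz continuous $F\in C^0(\mathbb{R}^N\times\mathbb{R}^d,\mathbb{R}^N)$,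 the non-autonomous ODE $\dot{x}(t)=F(x(t),z(t))$ is $V$-invariant with respect to $z$ if for any initial point $x_0\in V$ the solution $x:\mathbb{R}\to\mathbb{R}^N$ originating at $x_0$ satisfies $x(t)\in V$ for all $t\in\mathbb{R}^+$. For the reservoir system the driving inputs are $z(t)=\omega\phi^t(m)$, $m\in M$. - The reservoir system is uniformly $V$-asymptotically stable with respect to $\{\omega\phi^t(m)\}_{m\in M}$ if there exists a positive valued function $\psi:\mathbb{R}\to\mathbb{R}^+$ converging to $0$ (as $t\to\infty$) such that for all $m\in M$ and all initial points $x_0,y_0\in V$, the solutions $x_m(t)$ and $y_m(t)$ originating from $x_0,y_0$ satisfy $\|x_m(t)-y_m(t)\|\le\psi(t)$ for all $t\ge0$. - The reservoir system admits a uniform $V$-generalised synchronisation $f_{(\omega,\mathcal{V},F)}\in C^0(M,V)$ if there exists a positive function $\psi:\mathbb{R}\to\mathbb{R}^+$ converging to $0$ (as $t\to\infty$) such that for any initial $r\in V$ and any $m\in M$ the solution $x^r_m(t)$ satisfies $\|f_{(\omega,\mathcal{V},F)}\phi^t(m)-x^r_m(t)\|\le\psi(t)$ for all $t\ge0$.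
   Formalization: The inequality is required for all nonzero differences v of two points of V, rather than for all v in V; and V is also assumed closed and nonempty for the existence of the synchronisation f in C^0(M,V). The statement is false without these changes. *)

(* Defs.v *)
From HB Require Import structures.
From mathcomp Require Import all_boot all_order all_algebra.
From mathcomp Require Import all_classical all_reals all_analysis.
Set Implicit Arguments.
Unset Strict Implicit.
Unset Printing Implicit Defensive.
Import Order.TTheory GRing.Theory Num.Theory.
Import numFieldNormedType.Exports.
Local Open Scope classical_set_scope.
Local Open Scope ring_scope.

(* Points of R^n are row vectors.  The library norm on 'rV[R]_n is the sup
   norm; it is used for topology, boundedness and Lipschitz continuity, where
   the choice of norm is immaterial.  [enorm] is the Euclidean norm. *)
Definition dotv (R : realType) (n : nat) (u v : 'rV[R]_n) : R :=
  (u *m v^T) 0 0.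

Definition enorm (R : realType) (n : nat) (v : 'rV[R]_n) : R :=
  Num.sqrt (dotv v v).

(* f is C^k on U; only meant for U open. *)
Fixpoint Ck_on (R : realType) (E G : normedModType R) (k : nat)
    (U : set E) (f : E -> G) {struct k} : Prop :=
  match k with
  | 0%N => forall x, U x -> {for x, continuous f}
  | k'.+1 => (forall x, U x -> differentiable f x) /\
             (forall v, Ck_on k' U (fun x => 'd f x v))
  end.

Definition smooth_on (R : realType) (E G : normedModType R)
    (U : set E) (f : E -> G) : Prop := forall k, Ck_on k U f.

(* The two maps are total, but only their values on [chart_dom] and on its
   image are meaningful. *)
Record chart (R : realType) (n : nat) (M : topologicalType) := Chart {
  chart_dom : set M;
  chart_fun :> M -> 'rV[R]_n;
  chart_inv : 'rV[R]_n -> M;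
  chart_dom_open : open chart_dom;
  chart_img_open : open (chart_fun @` chart_dom);
  chart_funK : forall m, chart_dom m -> chart_inv (chart_fun m) = m;
  chart_fun_cont : forall m, chart_dom m -> {for m, continuous chart_fun};
  chart_inv_cont : forall y, (chart_fun @` chart_dom) y ->
    {for y, continuous chart_inv} }.

(* A smooth structure of dimension n on M, given by a smooth atlas (not
   necessarily maximal). *)
Record smooth_manifold (R : realType) (n : nat) (M : topologicalType) :=
  SmoothManifold {
  charts : set (chart R n M);
  manifold_hausdorff : hausdorff_space M;
  manifold_second_countable : @second_countable M;
  charts_cover : forall m : M, exists2 c, charts c & chart_dom c m;
  charts_compat : forall c c', charts c -> charts c' ->
    smooth_on (c @` (chart_dom c `&` chart_dom c')) (c' \o chart_inv c) }.

(* Vector fields are given by their coordinate representations in the charts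
   of the atlas, related by the differentials of the transition maps. *)
Record smooth_vector_field (R : realType) (n : nat) (M : topologicalType)
    (S : smooth_manifold R n M) := SmoothVectorField {
  vf_rep : chart R n M -> 'rV[R]_n -> 'rV[R]_n;
  vf_smooth : forall c, charts S c ->
    smooth_on (c @` chart_dom c) (vf_rep c);
  vf_compat : forall c c' m, charts S c -> charts S c' ->
    chart_dom c m -> chart_dom c' m ->
    vf_rep c' (c' m) = 'd (c' \o chart_inv c) (c m) (vf_rep c (c m)) }.

Definition C1_map (R : realType) (n : nat) (M : topologicalType)
    (S : smooth_manifold R n M) (g : M -> M) : Prop :=
  continuous g /\
  forall c c', charts S c -> charts S c' ->
    Ck_on 1 (c @` (chart_dom c `&` g @^-1` chart_dom c'))
      (c' \o g \o chart_inv c).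

Definition diffeo1 (R : realType) (n : nat) (M : topologicalType)
    (S : smooth_manifold R n M) (g : M -> M) : Prop :=
  exists h : M -> M,
    [/\ cancel g h, cancel h g, C1_map S g & C1_map S h].

(* [phi] is the global flow of the vector field X: a one-parameter group of
   C^1 diffeomorphisms whose orbits are integral curves of X.  As usual for
   flows, the action is jointly continuous; for the flow of a smooth vector
   field this is automatic. *)
Record evolution_operators (R : realType) (n : nat) (M : topologicalType)
    (S : smooth_manifold R n M) (X : smooth_vector_field S)
    (phi : R -> M -> M) : Prop := EvolutionOperators {
  evolution_diffeo : forall t, diffeo1 S (phi t);
  evolution_group : forall t1 t2, phi (t1 + t2) = phi t1 \o phi t2;
  evolution_continuous : continuous (fun p : R * M => phi p.1 p.2);
  evolution_integral : forall m t c, charts S c -> chart_dom c (phi t m) ->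
    is_derive t 1 (fun s : R => c (phi s m)) (vf_rep X c (c (phi t m))) }.

Section Reservoir.
Variables (R : realType) (N d : nat) (F : 'rV[R]_N * 'rV[R]_d -> 'rV[R]_N).

Definition solution (z : R -> 'rV[R]_d) (x : R -> 'rV[R]_N) : Prop :=
  forall t : R, is_derive t 1 x (F (x t, z t)).

Definition Dx (w : 'rV[R]_N) (z : 'rV[R]_d) : 'rV[R]_N -> 'rV[R]_N :=
  'd (fun x : 'rV[R]_N => F (x, z)) w.

(* Invariance is only defined for bounded driving inputs z. *)
Definition V_invariant (V : set 'rV[R]_N) (z : R -> 'rV[R]_d) : Prop :=
  [bounded z t | t in setT] /\
  forall x, solution z x -> V (x 0) -> forall t, 0 <= t -> V (x t).

Variables (M : Type) (phi : R -> M -> M) (omega : M -> 'rV[R]_d).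

Definition drive (m : M) : R -> 'rV[R]_d := fun t => omega (phi t m).

Definition uniformly_V_asymptotically_stable (V : set 'rV[R]_N) : Prop :=
  exists psi : R -> R,
    [/\ forall t, 0 < psi t,
        psi t @[t --> +oo] --> (0 : R) &
        forall m x y, solution (drive m) x -> solution (drive m) y ->
          V (x 0) -> V (y 0) ->
          forall t, 0 <= t -> enorm (x t - y t) <= psi t].

End Reservoir.

Definition uniform_V_generalised_synchronisation (R : realType) (N d : nat)
    (F : 'rV[R]_N * 'rV[R]_d -> 'rV[R]_N) (M : topologicalType)
    (phi : R -> M -> M) (omega : M -> 'rV[R]_d) (V : set 'rV[R]_N)
    (f : M -> 'rV[R]_N) : Prop :=
  [/\ continuous f,
      forall m, V (f m) &
      exists psi : R -> R,
        [/\ forall t, 0 < psi t,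
            psi t @[t --> +oo] --> (0 : R) &
            forall m x, solution F (drive phi omega m) x -> V (x 0) ->
              forall t, 0 <= t -> enorm (f (phi t m) - x t) <= psi t]].

(* Nonzero displacement vectors between points of V.  Up to scaling, these are
   the nonzero elements of V itself whenever 0 is an interior (or relatively
   interior) point of V. *)
Definition chord (R : realType) (N : nat) (V : set 'rV[R]_N)
    (v : 'rV[R]_N) : Prop :=
  v != 0 /\ exists x y, [/\ V x, V y & v = x - y].

(* Main.v *)
(** The Rayleigh-quotient bound, integrated along the segment joining two points
    of the convex set V (mean value theorem), is a one-sided Lipschitz bound
    <x - y, F(x,z) - F(y,z)> <= - delta |x - y|^2.  Along two trajectories in V
    whose inputs differ by at most e, g = |x - y|^2 therefore satisfies
    g' <= - 2 delta g + O(e), so that g(t) <= exp(-2 delta t) g(0) + O(e).  With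
    e = 0 this is uniform asymptotic stability.  The synchronisation is the
    pullback limit f(m) = lim_n x^r_{phi^{-n} m}(n): by stability the sequence is
    uniformly Cauchy and f(phi^t m) stays close to any trajectory driven by m,
    while each term is continuous in m by the estimate with e > 0 and the
    compactness of [0, n].  The trajectories exist by global Picard iteration. *)

Require Import Defs.
From HB Require Import structures.
From mathcomp Require Import all_boot all_order all_algebra.
From mathcomp Require Import all_classical all_reals all_analysis.
From mathcomp Require Import ring lra.
Set Implicit Arguments.
Unset Strict Implicit.
Unset Printing Implicit Defensive.
Import Order.TTheory GRing.Theory Num.Theory.
Import numFieldNormedType.Exports.
Local Open Scope classical_set_scope.
Local Open Scope ring_scope.

(** * Scalar comparison estimates and antiderivatives on the real line *)

Section RealDerivatives.
Variable R : realType.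
Implicit Types (f g df dg : R -> R) (a b c t : R).

Lemma is_derive1_continuous (W : normedModType R) (f df : R -> W) :
  (forall t, is_derive t (1 : R) f (df t)) -> continuous f.
Proof.
move=> fdf t; apply: differentiable_continuous; apply/derivable1_diffP.
by have [] := fdf t.
Qed.

Lemma le0_is_derive_le f df t : (forall s, is_derive s (1 : R) f (df s)) ->
  0 <= t -> (forall s, s \in `[0, t] -> df s <= 0) -> f t <= f 0.
Proof.
move=> fdf t0 df0.
have [|c ct] := MVT_segment t0 (fun x _ => fdf x).
  by apply: continuous_subspaceT; exact: is_derive1_continuous fdf.
rewrite subr0 => ftE; rewrite -subr_le0 ftE mulr_le0_ge0//.
by apply: df0; rewrite inE.
Qed.

Lemma is_derive_expRMl a t :
  is_derive t (1 : R) (fun s => expR (a * s)) (expR (a * t) * a).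
Proof.
rewrite -[X in is_derive _ _ X _]/(expR \o (fun s => a * s)).
apply: is_derive1_comp.
by apply: is_derive_eq; rewrite -[_ *: _]/(_ * _) mulr1.
Qed.

(** The integrating factor [expR (a * s)] turns the differential inequality into monotonicity: the
    derivative of [expR (a * s) * (f s - b / a)] is [expR (a * s) * (df s + a * f s - b)], which is
    nonpositive on [0, t]. *)
Lemma gronwall_le f df a b t : (forall s, is_derive s (1 : R) f (df s)) ->
  0 < a -> 0 <= t -> (forall s, s \in `[0, t] -> df s <= - a * f s + b) ->
  f t <= expR (- a * t) * (f 0 - b / a) + b / a.
Proof.
move=> fdf a0 t0 dfle.
pose h s := expR (a * s) * (f s - b / a).
pose dh s := expR (a * s) * (df s + a * (f s - b / a)).
have hdh s : is_derive s (1 : R) h (dh s).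
  have := fdf s => fs.
  have e := is_derive_expRMl a s.
  rewrite /h /dh; apply: is_derive_eq.
  rewrite subr0 -![_ *: _]/(_ * _); ring.
have hle : h t <= h 0.
  apply: (@le0_is_derive_le h dh) => // s st.
  rewrite /dh mulr_ge0_le0 ?expR_ge0//; have := dfle s st.
  by rewrite mulrBr mulrCA divff ?gt_eqF// mulr1; lra.
move: hle; rewrite /h mulr0 expR0 mul1r => hle.
rewrite -lerBlDr -(ler_pM2l (expR_gt0 (a * t))) (le_trans hle)//.
by rewrite mulrA -expRD mulNr subrr expR0 mul1r.
Qed.

Lemma exp_bound_right f df b c t : (forall s, is_derive s (1 : R) f (df s)) ->
  0 < c -> 0 <= b -> f 0 = 0 ->
  (forall s, `|df s| <= b * expR (c * `|s|)) ->
  0 <= t -> f t <= b / c * expR (c * t).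
Proof.
move=> fdf c0 b0 f0 dfle t0.
pose h s := f s - b / c * expR (c * s).
have hdh s : is_derive s (1 : R) h (df s - b * expR (c * s)).
  have := fdf s => fs.
  have e := is_derive_expRMl c s.
  rewrite /h; apply: is_derive_eq; rewrite -![_ *: _]/(_ * _).
  have : c != 0 by rewrite gt_eqF.
  by move=> ?; field.
have hle : h t <= h 0.
  apply: (le0_is_derive_le hdh) => // s; rewrite in_itv/= => /andP[s0 _].
  have := dfle s.
  by rewrite (ger0_norm s0) subr_le0; apply: le_trans; rewrite ler_norm.
move: hle; rewrite /h f0 mulr0 expR0 mulr1 => hle.
have : 0 <= b / c by rewrite divr_ge0// ltW.
lra.
Qed.

(** Integration from 0 gains a factor [1 / c] in the norm weighted by exp(c|t|); this gain makes the
    Picard operator a contraction on the whole line. Negative times reduce to positive ones by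
    reflection. *)
Lemma exp_bound f df b c t : (forall s, is_derive s (1 : R) f (df s)) ->
  0 < c -> 0 <= b -> f 0 = 0 ->
  (forall s, `|df s| <= b * expR (c * `|s|)) ->
  `|f t| <= b / c * expR (c * `|t|).
Proof.
move=> + c0 b0.
wlog t0 : f df t / 0 <= t => [hw fdf f0 dfle|].
  have [t0|/ltW t0] := leP 0 t; first exact: (hw f df t).
  have := hw (f \o -%R) (fun s => - df (- s)) (- t).
  rewrite /= opprK normrN oppr_ge0; apply=> //.
  - move=> s; rewrite -[X in is_derive _ _ _ X]mulrN1.
    by apply: is_derive1_comp.
  - by rewrite oppr0.
  - by move=> s; rewrite normrN; have := dfle (- s); rewrite normrN.
move=> fdf f0 dfle.
rewrite ler_norml (ger0_norm t0) (exp_bound_right fdf)// andbT.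
rewrite lerNl; apply: (@exp_bound_right (- f) (- df)) => //.
- by rewrite -[(- f) 0]/(- f 0) f0 oppr0.
- by move=> s; rewrite -[(- df) s]/(- df s) normrN.
Qed.

Lemma antiderivative f : continuous f ->
  exists g, g 0 = 0 /\ forall t, is_derive t (1 : R) g (f t).
Proof.
move=> cf.
pose I a (x : R) := (\int[lebesgue_measure]_(t in `[a, x]) f t)%R.
have If a b : (lebesgue_measure : measure _ _).-integrable `[a, b] (EFin \o f).
  apply: continuous_compact_integrable; first exact: segment_compact.
  exact: continuous_subspaceT.
have Id a x : a < x -> is_derive x (1 : R) (I a) (f x).
  move=> ax.
  have xx1 : x < x + 1 by rewrite ltrDl.
  have [dI <-] := continuous_FTC1_closed xx1 (If _ _) ax (cf x).
  by rewrite derive1E; apply: DeriveDef.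
have Isplit a b x : a <= b -> b <= x -> I a x = I a b + I b x.
  move=> ab bx; apply/eqP; rewrite addrC -subr_eq; apply/eqP.
  rewrite /I (Rintegral_itvB (If a x)) ?bnd_simp//.
  apply: Rintegral_itv_obnd_cbnd.
  by apply: integrableS (If b x) => //; apply: subset_itvr; rewrite bnd_simp.
(* Moving the base point with x covers the whole line with integrals over
   segments to the right of their base point. *)
pose g x := I (- `|x| - 1) x - I (- `|x| - 1) 0.
exists g; split=> [|t]; first by rewrite /g subrr.
(* This base point lies to the left of [- |x| - 1] for every x with |x| <= |t| + 1, so near t
   additivity of the integral replaces the moving base point by the fixed one [a]. *)
pose a := - (`|t| + 1) - 1.
have at_ : a < t by rewrite /a; have := ler_norm (- t); rewrite normrN; lra.
have dh : is_derive t (1 : R) (fun x => I a x - I a 0) (f t).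
  have := Id a t at_ => ?; apply: is_derive_eq; exact: subr0.
apply: near_eq_is_derive dh.
near=> x.
have xt : `|x| <= `|t| + 1.
  rewrite -lerBlDl (le_trans (lerB_dist _ _))// distrC ltW//.
rewrite /g (Isplit a (- `|x| - 1) x) ?(Isplit a (- `|x| - 1) 0).
- ring.
- by rewrite /a; lra.
- by have := normr_ge0 x; lra.
- by rewrite /a; lra.
- by have := ler_norm (- x); rewrite normrN; lra.
Unshelve. all: by end_near. Qed.

End RealDerivatives.

(** * Coordinatewise calculus and limits for row vectors *)

Section RowVectors.
Variables (R : realType) (N : nat).
Implicit Types (u v w : 'rV[R]_N) (x y dx : R -> 'rV[R]_N).

Lemma rV_norm_coord u i : `|u 0 i| <= `|u|.
Proof.
rewrite [leRHS]/Num.norm/= mx_normrE.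
exact: (le_bigmax _ (fun ij => `|u ij.1 ij.2|) (0, i)).
Qed.

Lemma rV_norm_le u c : 0 <= c -> (forall i, `|u 0 i| <= c) -> `|u| <= c.
Proof.
move=> c0 uc; rewrite [leLHS]/Num.norm/= mx_normrE.
by apply: bigmax_le => // -[i j] _; rewrite ord1; exact: uc.
Qed.

Lemma is_derive_rVP x v (t : R) :
  is_derive t (1 : R) x v <->
  forall i, is_derive t (1 : R) (fun s => x s 0 i) (v 0 i).
Proof.
split=> [[xt <-] i|xt].
  apply: DeriveDef; first by move/derivable_mxP : xt => /(_ 0 i).
  by rewrite derive_mx// mxE.
have dx : derivable x t 1.
  by apply/derivable_mxP => i j; rewrite ord1; have [] := xt j.
apply: DeriveDef => //; apply/rowP => i.
by rewrite derive_mx// mxE; have [] := xt i.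
Qed.

Lemma is_derive_rV_shift x v (t k : R) :
  is_derive (t + k) (1 : R) x v -> is_derive t (1 : R) (fun s => x (s + k)) v.
Proof.
move/is_derive_rVP => xt; apply/is_derive_rVP => i.
have := @is_derive1_comp R (fun s => x s 0 i) (fun s => s + k) t _ 1 (xt i).
rewrite mulr1; apply; rewrite -[X in is_derive _ _ _ X]addr0.
exact: is_deriveD.
Qed.

Lemma exp_bound_rV x dx b c t : (forall s, is_derive s (1 : R) x (dx s)) ->
  0 < c -> 0 <= b -> x 0 = 0 ->
  (forall s, `|dx s| <= b * expR (c * `|s|)) ->
  `|x t| <= b / c * expR (c * `|t|).
Proof.
move=> xdx c0 b0 x0 dxle; apply: rV_norm_le => [|i].
  by rewrite mulr_ge0 ?expR_ge0// divr_ge0// ltW.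
apply: (@exp_bound R (fun s => x s 0 i) (fun s => dx s 0 i)) => // [s||s].
- by have /is_derive_rVP := xdx s; apply.
- by rewrite x0 mxE.
- exact: le_trans (rV_norm_coord _ _) (dxle s).
Qed.

Lemma antiderivative_rV (r : 'rV[R]_N) x : continuous x ->
  exists y, y 0 = r /\ forall t, is_derive t (1 : R) y (x t).
Proof.
move=> cx.
have cxi i : continuous (fun t => x t 0 i).
  move=> t; apply: (@continuous_comp _ _ _ x (fun u => u 0 i)); first exact: cx.
  exact: coord_continuous.
have /choice[g gP] : forall i, exists g : R -> R,
    g 0 = 0 /\ forall t, is_derive t (1 : R) g (x t 0 i).
  by move=> i; exact: antiderivative.
exists (fun t => r + \row_i g i t); split=> [|t].
  by apply/rowP => i; rewrite !mxE (gP i).1 addr0.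
apply/is_derive_rVP => i; have := (gP i).2 t => gi.
under eq_fun do rewrite !mxE.
rewrite -[X in is_derive _ _ _ X]add0r; exact: is_deriveD.
Qed.

(** Letting k tend to infinity in the Cauchy bound gives the error bound for the limit. It serves
    both the Picard iterates and the pullback sequence. *)
Lemma geometric_cauchy_rV (u : nat -> 'rV[R]_N) (e : nat -> R) :
  (e n @[n --> \oo] --> (0 : R)) ->
  (forall n k, `|u (n + k)%N - u n| <= e n) ->
  exists l : 'rV[R]_N, u n @[n --> \oo] --> l /\ forall n, `|l - u n| <= e n.
Proof.
move=> e0 ue.
have ucvg : cvg (u n @[n --> \oo]).
  apply/cauchy_cvgP/cauchy_exP => eps eps0.
  have /cvgrPdist_lt/(_ _ eps0) [n _ en] := e0.
  exists (u n); exists n => //= m nm.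
  rewrite -ball_normE /ball_/= distrC -(subnKC nm) (le_lt_trans (ue _ _))//.
  rewrite (le_lt_trans (ler_norm _))//; have := en n (leqnn n).
  by rewrite sub0r normrN.
exists (lim (u n @[n --> \oo])); split=> // n.
have h : `|u m - u n| @[m --> \oo] --> `|lim (u n @[n --> \oo]) - u n|.
  by apply: cvg_norm; apply: cvgB => //; exact: cvg_cst.
apply: (cvgr_to_le h).
by exists n => // m nm; rewrite -(subnKC nm).
Qed.

(** The three-epsilon argument localised at [m]: the approximation has to be uniform only near [m],
    which suits limits that are merely locally uniform. *)
Lemma continuous_at_approx (T : topologicalType) (f : T -> 'rV[R]_N) (m : T) :
  (forall e : R, 0 < e -> exists2 g : T -> 'rV[R]_N, {for m, continuous g} &
     \forall p \near m, `|f p - g p| <= e) -> {for m, continuous f}.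
Proof.
move=> fg; apply/cvgrPdist_le => e e0.
have e3 : 0 < e / 3 by rewrite divr_gt0.
have [g gm gf] := fg _ e3.
have gfm := nbhs_singleton gf.
near=> p.
have -> : f m - f p = (f m - g m) + (g m - g p) + (g p - f p).
  by rewrite !addrA !subrK.
have -> : e = e / 3 + e / 3 + e / 3 by field.
rewrite (le_trans (ler_normD _ _))// lerD//.
  rewrite (le_trans (ler_normD _ _))// lerD//.
  by near: p; move/cvgrPdist_le : gm; exact.
by rewrite distrC; near: p.
Unshelve. all: by end_near. Qed.

End RowVectors.

(** * Global existence of solutions by Picard iteration *)

Section GlobalPicard.
Variables (R : realType) (N d : nat) (F : 'rV[R]_N * 'rV[R]_d -> 'rV[R]_N).
Variables (K : R) (K0 : 0 < K).
Hypothesis FK : forall p q, `|F p - F q| <= K * `|p - q|.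
Variables (z : R -> 'rV[R]_d) (zcont : continuous z).

Lemma lipschitz_state x y w : `|F (x, w) - F (y, w)| <= K * `|x - y|.
Proof.
apply: le_trans (FK _ _) _; rewrite ler_pM2l//.
by rewrite prod_normE/= subrr normr0 ge_max lexx normr_ge0.
Qed.

Lemma lipschitz_input x v w : `|F (x, v) - F (x, w)| <= K * `|v - w|.
Proof.
apply: le_trans (FK _ _) _; rewrite ler_pM2l//.
by rewrite prod_normE/= subrr normr0 ge_max lexx normr_ge0.
Qed.

Lemma lipschitz_continuous : continuous F.
Proof.
move=> p; apply/cvgrPdist_le => e e0.
near=> q; rewrite (le_trans (FK _ _))// mulrC -ler_pdivlMr//.
by near: q; move/cvgrPdist_le : (@cvg_id _ (nbhs p)); apply; rewrite divr_gt0.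
Unshelve. all: by end_near. Qed.

(** Boundedness of [z] bounds F(r, z s) uniformly in s, so the first Picard step is finite in the
    weighted norm; later steps halve, and the iterates converge locally uniformly to a fixed
    point. *)
Lemma global_solution_exists (r : 'rV[R]_N) : [bounded z t | t in setT] ->
  exists x, solution F z x /\ x 0 = r.
Proof.
move=> /pinfty_ex_gt0[Bz Bz0 zB].
pose G (x : R -> 'rV[R]_N) t := F (x t, z t).
have Gcont x : continuous x -> continuous (G x).
  move=> cx t; apply: (@continuous_comp _ _ _ (fun t => (x t, z t)) F).
    exact: (cvg_pair (cx t) (@zcont t)).
  exact: lipschitz_continuous.
(* Continuity of [x] is a premise inside the existential, so that [T] is a total operator, with an
   arbitrary value at discontinuous functions. *)
have /choice[T TP] : forall x : R -> 'rV[R]_N, exists y : R -> 'rV[R]_N,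
    continuous x -> y 0 = r /\ forall t, is_derive t (1 : R) y (G x t).
  move=> x; have [cx|ncx] := pselect (continuous x); last by exists x.
  by have [y yP] := antiderivative_rV r (Gcont _ cx); exists y.
have Tcont x : continuous x -> continuous (T x).
  by move=> cx; exact: is_derive1_continuous (TP _ cx).2.
(* The weight exp(2K|t|) makes T a contraction of ratio 1/2 on the whole line. *)
have Tdiff x y c : continuous x -> continuous y -> 0 <= c ->
    (forall t, `|x t - y t| <= c * expR (2 * K * `|t|)) ->
    forall t, `|T x t - T y t| <= c * 2^-1 * expR (2 * K * `|t|).
  move=> cx cy c0 xy t.
  (* Here [c * K] bounds the derivative through the Lipschitz constant, and [2 * K] is the
     exponential rate by which integration divides. *)
  have -> : c * 2^-1 = c * K / (2 * K) by field; rewrite gt_eqF.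
  apply: (exp_bound_rV (x := fun t => T x t - T y t)
    (dx := fun t => G x t - G y t)).
  - move=> s; have := (TP _ cx).2 s => ?; have := (TP _ cy).2 s => ?.
    exact: is_deriveB.
  - by rewrite mulr_gt0.
  - by rewrite mulr_ge0// ltW.
  - by rewrite (TP _ cx).1 (TP _ cy).1 subrr.
  - move=> s; rewrite (le_trans (lipschitz_state _ _ _))//.
    by rewrite (mulrC c) -mulrA ler_pM2l.
pose X n := iter n T (cst r).
have Xcont n : continuous (X n).
  by elim: n => [|n IHn]; [exact: cst_continuous|exact: Tcont].
pose B := `|F (r, 0)| + K * Bz.
have B0 : 0 <= B by rewrite addr_ge0// mulr_ge0// ltW.
have X0 t : `|X 1%N t - X 0%N t| <= B / (2 * K) * expR (2 * K * `|t|).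
  apply: (exp_bound_rV (x := fun t => X 1%N t - r) (dx := G (cst r))) => //.
  - move=> s; have := (TP _ (Xcont 0%N)).2 s => ?.
    by rewrite -[X in is_derive _ _ _ X]subr0; exact: is_deriveB.
  - by rewrite mulr_gt0.
  - by rewrite -[X 1%N 0]/(T (X 0%N) 0) (TP _ (Xcont 0%N)).1 subrr.
  - move=> s; apply: (@le_trans _ _ B); last first.
      rewrite ler_peMr// -expR0 ler_expR mulr_ge0// mulr_ge0//.
      exact: ltW.
    rewrite /G /B -[F (r, z s)](subrK (F (r, 0))).
    rewrite (le_trans (ler_normD _ _))// addrC lerD2l.
    rewrite (le_trans (lipschitz_input _ _ _))// ler_pM2l// subr0.
    exact: zB.
pose C := B / (2 * K).
have C0 : 0 <= C by rewrite divr_ge0// mulr_ge0// ltW.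
have CX0 n : 0 <= C * 2^-1 ^+ n by rewrite mulr_ge0// exprn_ge0.
have Xstep n t : `|X n.+1 t - X n t| <= C * 2^-1 ^+ n * expR (2 * K * `|t|).
  elim: n t => [|n IHn] t; first by rewrite mulr1; exact: X0.
  by rewrite exprSr mulrA; apply: (Tdiff (X n.+1) (X n)).
have Xcauchy t n k : `|X (n + k)%N t - X n t| <=
    geometric (2 * C * expR (2 * K * `|t|)) 2^-1 n.
  have Et := expR_gt0 (2 * K * `|t|).
  (* The exact partial sum of the geometric series is kept, since the weaker bound without the
     subtracted term is not inductive in k. *)
  suff : `|X (n + k)%N t - X n t| <=
      2 * (C * expR (2 * K * `|t|)) * (2^-1 ^+ n - 2^-1 ^+ (n + k)).
    move/le_trans; apply; rewrite /geometric/= mulrA ler_wpM2l//.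
      by rewrite mulr_ge0// mulr_ge0// ltW.
    by rewrite gerBl exprn_ge0.
  elim: k => [|k IHk]; first by rewrite addn0 !subrr mulr0 normr0.
  rewrite addnS -(subrK (X (n + k)%N t) (X (n + k).+1 t)) -addrA.
  rewrite (le_trans (ler_normD _ _))// (le_trans (lerD (Xstep _ t) IHk))//.
  by rewrite exprSr le_eqVlt; apply/orP; left; apply/eqP; field.
have geo0 c : geometric c 2^-1 n @[n --> \oo] --> (0 : R).
  by apply: cvg_geometric; rewrite ger0_norm// invf_lt1// ltr1n.
have /choice[x xX] : forall t, exists l : 'rV[R]_N, forall n, `|l - X n t| <=
    geometric (2 * C * expR (2 * K * `|t|)) 2^-1 n.
  move=> t; have [l [_ lX]] := geometric_cauchy_rV (geo0 _) (Xcauchy t).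
  by exists l.
have xcont : continuous x.
  move=> t; apply: continuous_at_approx => e e0.
  have /cvgrPdist_le/(_ _ e0)[n _ /(_ n (leqnn n))] :=
    geo0 (2 * C * expR (2 * K * (`|t| + 1))).
  rewrite sub0r normrN => /(le_trans (ler_norm _)) en.
  exists (X n); first exact: Xcont.
  near=> s.
  (* Near t the weight at s is at most the weight at |t| + 1, for which n was chosen. *)
  have ts : `|s| <= `|t| + 1.
    rewrite -lerBlDl (le_trans (lerB_dist _ _))// distrC.
  rewrite (le_trans (xX _ _))// (le_trans _ en)// /geometric/=.
  rewrite ler_wpM2r ?exprn_ge0// ler_wpM2l//.
    by rewrite mulr_ge0.
  by rewrite ler_expR ler_pM2l // mulr_gt0.
have Txx t : T x t = x t.
  apply/eqP; rewrite -subr_eq0 -normr_le0.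
  apply: (cvgr_to_ge (geo0 (2 * C * expR (2 * K * `|t|)))).
  near=> n.
  (* Both [T x t] and [x t] are compared with the iterate n + 1; each error is half of the geometric
     term of index n. *)
  rewrite -(subrK (X n.+1 t) (T x t)) -addrA.
  rewrite (le_trans (ler_normD _ _))// [`|X n.+1 t - x t|]distrC.
  have h1 := xX t n.+1.
  have h2 : `|T x t - X n.+1 t| <=
      2 * C * 2^-1 ^+ n * 2^-1 * expR (2 * K * `|t|).
    apply: (Tdiff x (X n)) => // [|s].
      by rewrite -mulrA mulr_ge0.
    apply: le_trans (xX _ _) _; rewrite /geometric/= le_eqVlt; apply/orP; left.
    by apply/eqP; ring.
  apply: le_trans (lerD h2 h1) _.
  by rewrite /geometric/= exprSr le_eqVlt; apply/orP; left; apply/eqP; field.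
exists x; split=> [t|]; last by rewrite -Txx (TP _ xcont).1.
have <- : T x = x by apply/funext.
by have := (TP _ xcont).2 t; rewrite /G Txx.
Unshelve. all: by end_near. Qed.

End GlobalPicard.

(** * The Euclidean inner product and its comparison with the sup norm *)

Section Euclidean.
Variables (R : realType) (N : nat).
Implicit Types (u v w : 'rV[R]_N).

Lemma dotvE u v : dotv u v = \sum_i u 0 i * v 0 i.
Proof. by rewrite /dotv mxE; apply: eq_bigr => i _; rewrite mxE. Qed.

Lemma dotv0l u : dotv 0 u = 0.
Proof. by rewrite /dotv mul0mx mxE. Qed.

Lemma dotvDr u v w : dotv u (v + w) = dotv u v + dotv u w.
Proof. by rewrite /dotv linearD/= mulmxDr mxE. Qed.

Lemma dotvNr u v : dotv u (- v) = - dotv u v.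
Proof. by rewrite /dotv linearN/= mulmxN mxE. Qed.

Lemma dotvC u v : dotv u v = dotv v u.
Proof. by rewrite !dotvE; apply: eq_bigr => i _; rewrite mulrC. Qed.

Lemma dotv_ge0 u : 0 <= dotv u u.
Proof. by rewrite dotvE sumr_ge0// => i _; rewrite -expr2 sqr_ge0. Qed.

Lemma enorm_sqr u : enorm u ^+ 2 = dotv u u.
Proof. by rewrite sqr_sqrtr// dotv_ge0. Qed.

Lemma norm_le_enorm u : `|u| <= enorm u.
Proof.
apply: rV_norm_le => [|i]; first exact: sqrtr_ge0.
rewrite -sqrtr_sqr ler_wsqrtr// dotvE (bigD1 i)//= expr2 lerDl.
by rewrite sumr_ge0// => j _; rewrite -expr2 sqr_ge0.
Qed.

Lemma normr_dotv_le u v : `|dotv u v| <= N%:R * (`|u| * `|v|).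
Proof.
rewrite dotvE (le_trans (ler_norm_sum _ _ _))//.
rewrite (@le_trans _ _ (\sum_(i < N) `|u| * `|v|))//; last first.
  by rewrite sumr_const card_ord mulr_natl.
by apply: ler_sum => i _; rewrite normrM ler_pM// rV_norm_coord.
Qed.

(** The sharp constant is the square root of N; the cruder N follows from N <= N^2 and avoids a
    further root. *)
Lemma enorm_le u : enorm u <= N%:R * `|u|.
Proof.
rewrite -[leRHS]ger0_norm ?mulr_ge0// -sqrtr_sqr ler_wsqrtr//.
rewrite (le_trans (ler_norm _))// (le_trans (normr_dotv_le _ _))//.
rewrite exprMn -expr2 ler_wpM2r ?sqr_ge0// -natrX ler_nat.
by case: N => // k; rewrite leq_pmulr.
Qed.

Lemma is_derive_dotv (x y : R -> 'rV[R]_N) (dx dy : 'rV[R]_N) (t : R) :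
  is_derive t (1 : R) x dx -> is_derive t (1 : R) y dy ->
  is_derive t (1 : R) (fun s => dotv (x s) (y s))
    (dotv dx (y t) + dotv (x t) dy).
Proof.
move=> /is_derive_rVP xt /is_derive_rVP yt.
have := @is_derive_sum R R R N (fun i s => x s 0 i * y s 0 i) t 1
  (fun i => dx 0 i * y t 0 i + x t 0 i * dy 0 i).
have -> : \sum_i (fun s => x s 0 i * y s 0 i) = (fun s => dotv (x s) (y s)).
  by apply/funext => s; rewrite fct_sumE dotvE.
rewrite big_split/= -!dotvE; apply => i.
have := xt i => xi; have := yt i => yi; apply: is_derive_eq.
by rewrite -![_ *: _]/(_ * _) addrC mulrC.
Qed.

End Euclidean.

(** * From the Rayleigh-quotient bound to the distance between solutions *)

Section OneSidedLipschitz.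
Variables (R : realType) (N d : nat) (F : 'rV[R]_N * 'rV[R]_d -> 'rV[R]_N).
Variables (V : set 'rV[R]_N) (Z : set 'rV[R]_d) (delta : R).
Hypothesis Fdiff : forall p, differentiable F p.
Hypothesis Vconvex : convex_set V.
Hypothesis DxF : forall w v z, V w -> chord V v -> Z z ->
  dotv v (Dx F w z v) / enorm v ^+ 2 < - delta.

Lemma is_derive_segment (y u : 'rV[R]_N) z (s : R) :
  is_derive s (1 : R) (fun s : R => F (y + s *: u, z)) (Dx F (y + s *: u) z u).
Proof.
pose l (s : R) : 'rV[R]_N := y + s *: u.
pose Fz (w : 'rV[R]_N) := F (w, z).
have ldiff : is_derive s (1 : R) l u.
  apply/is_derive_rVP => i; under eq_fun do rewrite !mxE.
  by apply: is_derive_eq; rewrite add0r scaler0 add0r mul1r; exact: mulr1.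
have Fzdiff w : differentiable Fz w.
  apply: (@differentiable_comp _ _ _ _ (fun w => (w, z)) F) => //.
have ld : differentiable l s by apply/derivable1_diffP; exact: ex_derive.
have cd : differentiable (Fz \o l) s by exact: differentiable_comp.
apply: DeriveDef; first exact: diff_derivable.
rewrite deriveE// [LHS](congr1 (@^~ 1) (diff_comp ld (Fzdiff (l s))))/=.
by rewrite -(deriveE (1 : R) ld) derive_val.
Qed.

(** The mean value theorem is applied to the scalar function s -> <u, F(y + s u, z)> on [0, 1], with
    u = x - y. Its derivative at c is the quadratic form of [Dx F] in the chord direction u, at a
    point of V by convexity. *)
Lemma one_sided_lipschitz x y z : V x -> V y -> Z z ->
  dotv (x - y) (F (x, z) - F (y, z)) <= - delta * dotv (x - y) (x - y).
Proof.
move=> Vx Vy Zz; have [->|u0] := eqVneq (x - y) 0.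
  by rewrite !dotv0l mulr0.
set u := x - y in u0 *.
pose h s := dotv u (F (y + s *: u, z)).
have hd s : is_derive s (1 : R) h (dotv u (Dx F (y + s *: u) z u)).
  have := is_derive_dotv (is_derive_cst u s 1) (is_derive_segment y u z s).
  by rewrite dotv0l add0r.
have [|c c01] := MVT (@ltr01 R) (fun s _ => hd s).
  by apply: continuous_subspaceT; exact: is_derive1_continuous hd.
rewrite subr0 mulr1 /h scale1r scale0r addr0 -dotvNr -dotvDr.
have -> : y + u = x by rewrite addrC subrK.
move=> ->; rewrite -enorm_sqr.
move: c01; rewrite in_itv/= => /andP[/ltW c0 /ltW c1].
have Vc : V (y + c *: u).
  have /set_mem := @Vconvex x y (Itv01 c0 c1) (mem_set Vx) (mem_set Vy).
  congr V; rewrite /conv/= /u scalerBr addrCA addrA.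
  by rewrite /unstable.onem scalerBl scale1r addrA.
have enu : 0 < enorm u ^+ 2.
  by rewrite exprn_gt0// (lt_le_trans _ (norm_le_enorm _))// normr_gt0.
have := DxF Vc (conj u0 (ex_intro _ x (ex_intro _ y (And3 Vx Vy erefl)))) Zz.
by rewrite ltr_pdivrMr// => /ltW.
Qed.

Variables (K : R) (K0 : 0 < K) (D : R) (D0 : 0 <= D) (delta0 : 0 < delta).
Hypothesis FK : forall p q, `|F p - F q| <= K * `|p - q|.
Hypothesis VD : forall x y, V x -> V y -> `|x - y| <= D.

Lemma solutions_close (z z' : R -> 'rV[R]_d) x y (e t : R) :
  0 <= e -> 0 <= t -> solution F z x -> solution F z' y ->
  (forall s, s \in `[0, t] ->
     [/\ V (x s), V (y s), Z (z s) & `|z s - z' s| <= e]) ->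
  dotv (x t - y t) (x t - y t) <=
    expR (- (2 * delta) * t) * dotv (x 0 - y 0) (x 0 - y 0)
    + N%:R * (D * (K * e)) / delta.
Proof.
move=> e0 t0 xsol ysol xyV.
pose u s := x s - y s.
pose du s := F (x s, z s) - F (y s, z' s).
have hu s : is_derive s (1 : R) u (du s).
  by have := xsol s => ?; have := ysol s => ?; exact: is_deriveB.
have hg s := is_derive_dotv (hu s) (hu s).
pose b := N%:R * (D * (K * e)).
have b0 : 0 <= b by rewrite mulr_ge0// mulr_ge0// mulr_ge0// ltW.
have := @gronwall_le R _ _ (2 * delta) (2 * b) t hg.
have -> : 2 * b / (2 * delta) = b / delta.
  by field; rewrite gt_eqF.
move=> /(_ _ t0) H; apply: le_trans (H _ _) _.
- by rewrite mulr_gt0.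
- move=> s st; have [Vx Vy Zz zz'] := xyV s st.
  (* The change of state at a common input is dissipative; the change of input at a common state
     contributes at most [b] to the inner product, by the Lipschitz bound. *)
  have -> : du s = (F (x s, z s) - F (y s, z s))
      + (F (y s, z s) - F (y s, z' s)) by rewrite addrA subrK.
  have h1 := one_sided_lipschitz Vx Vy Zz.
  have h2 : dotv (u s) (F (y s, z s) - F (y s, z' s)) <= b.
    rewrite (le_trans (ler_norm _))// (le_trans (normr_dotv_le _ _))//.
    rewrite ler_wpM2l// ler_pM//; first exact: VD.
    by rewrite (le_trans (lipschitz_input K0 FK _ _ _))// ler_pM2l.
  rewrite dotvC dotvDr.
  have := lerD h1 h2.
  rewrite -/(u s); lra.
- rewrite lerD2r ler_wpM2l ?expR_ge0// gerBl divr_ge0//; exact: ltW.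
Qed.

End OneSidedLipschitz.

(** * Uniform stability and the pullback construction *)

Section Synchronisation.
Variables (R : realType) (N d : nat) (M : topologicalType).
Variables (phi : R -> M -> M) (omega : M -> 'rV[R]_d).
Hypothesis phi_id : forall m, phi 0 m = m.
Hypothesis phi_group : forall t1 t2 m, phi (t1 + t2) m = phi t1 (phi t2 m).
Hypothesis phi_continuous : continuous (fun p : R * M => phi p.1 p.2).
Hypothesis omega_continuous : continuous omega.
Variables (F : 'rV[R]_N * 'rV[R]_d -> 'rV[R]_N) (V : set 'rV[R]_N).
Variables (delta K D : R).
Hypothesis delta0 : 0 < delta.
Hypothesis K0 : 0 < K.
Hypothesis D0 : 0 <= D.
Hypothesis Fdiff : forall p, differentiable F p.
Hypothesis FK : forall p q, `|F p - F q| <= K * `|p - q|.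
Hypothesis VD : forall x y, V x -> V y -> `|x - y| <= D.
Hypothesis Vconvex : convex_set V.
Hypothesis Vinv : forall m, V_invariant F V (drive phi omega m).
Hypothesis DxF : forall w v z, V w -> chord V v -> range omega z ->
  dotv v (Dx F w z v) / enorm v ^+ 2 < - delta.

Lemma solution_shift m x k : solution F (drive phi omega m) x ->
  solution F (drive phi omega (phi k m)) (fun t => x (t + k)).
Proof.
move=> xsol t; apply: is_derive_rV_shift.
by rewrite /drive -phi_group; exact: xsol.
Qed.

Lemma drive_continuous m : continuous (drive phi omega m).
Proof.
move=> t; rewrite /drive.
apply: (@continuous_comp _ _ _ (fun t => phi t m) omega); last first.
  exact: omega_continuous.
apply: (@continuous_comp _ _ _ (fun t => (t, m)) (fun p : R * M => phi p.1 p.2)).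
  exact: (cvg_pair (@cvg_id _ (nbhs t)) (cvg_cst m)).
exact: phi_continuous.
Qed.

(** [N%:R * D] bounds the Euclidean distance between two points of V; adding 1 keeps the rate
    positive when this bound is zero. *)
Let rate t := (N%:R * D + 1) * expR (- (delta * t)).

Lemma rate_gt0 t : 0 < rate t.
Proof. by rewrite mulr_gt0 ?expR_gt0// ltr_wpDl// mulr_ge0. Qed.

Lemma rate_cvg0 : rate t @[t --> +oo] --> (0 : R).
Proof.
rewrite -(mulr0 (N%:R * D + 1)); apply: cvgMr.
apply: (@cvg_comp _ _ _ (fun t => delta * t) (fun t => expR (- t))); last first.
  exact: cvgr_expR.
by apply: gt0_cvgMry => //; exact: cvg_id.
Qed.

(** This is [solutions_close] with equal inputs, e = 0; the square root turns the exponent 2 delta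
    into delta. *)
Lemma solutions_contract m x y t :
  solution F (drive phi omega m) x -> solution F (drive phi omega m) y ->
  V (x 0) -> V (y 0) -> 0 <= t -> enorm (x t - y t) <= rate t.
Proof.
move=> xsol ysol Vx Vy t0.
have := solutions_close Fdiff Vconvex DxF K0 D0 delta0 FK VD (lexx 0) t0
  xsol ysol.
rewrite !mulr0 mul0r addr0 => /(_ _) xyt.
have {}xyt : dotv (x t - y t) (x t - y t) <=
    expR (- (2 * delta) * t) * dotv (x 0 - y 0) (x 0 - y 0).
  apply: xyt => s; rewrite in_itv/= => /andP[s0 _]; split.
  - exact: (Vinv m).2.
  - exact: (Vinv m).2.
  - by exists (phi s m).
  - by rewrite subrr normr0.
have -> : enorm (x t - y t) = Num.sqrt (dotv (x t - y t) (x t - y t)) by [].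
apply: (@le_trans _ _ (Num.sqrt (rate t ^+ 2))); last first.
  by rewrite sqrtr_sqr ger0_norm// ltW// rate_gt0.
rewrite ler_wsqrtr// (le_trans xyt)// exprMn mulrC.
have -> : expR (- (2 * delta) * t) = expR (- (delta * t)) ^+ 2.
  by rewrite -expRM_natl; congr expR; ring.
have ND0 : 0 <= N%:R * D + 1 by rewrite addr_ge0// mulr_ge0.
rewrite ler_wpM2r ?exprn_ge0 ?expR_ge0// -enorm_sqr.
rewrite ler_sqr ?nnegrE ?sqrtr_ge0// (le_trans (enorm_le _))//.
by rewrite (@le_trans _ _ (N%:R * D)) ?lerDl// ler_wpM2l// VD.
Qed.

Lemma asymptotic_stability : uniformly_V_asymptotically_stable F phi omega V.
Proof.
exists rate; split=> [t||m x y xsol ysol Vx Vy t t0].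
- exact: rate_gt0.
- exact: rate_cvg0.
- exact: (solutions_contract xsol ysol).
Qed.

(** A tube-lemma argument: the input is jointly continuous in time and base point, and compactness
    of [0, T] yields one neighbourhood of [m] valid for all times. *)
Lemma near_drive_close (c T e : R) m : 0 < e -> \forall p \near m,
  forall s, s \in `[0, T] ->
    `|drive phi omega (phi c m) s - drive phi omega (phi c p) s| <= e.
Proof.
move=> e0.
pose H (q : R * M) := drive phi omega (phi c q.2) q.1.
have Hcont : continuous H.
  move=> q; have -> : H = fun q => omega (phi (q.1 + c) q.2).
    by apply/funext => p; rewrite /H /drive phi_group.
  apply: (@continuous_comp _ _ _ (fun q => phi (q.1 + c) q.2) omega); last first.
    exact: omega_continuous.
  apply: (@continuous_comp _ _ _ (fun q : R * M => (q.1 + c, q.2))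
    (fun p : R * M => phi p.1 p.2)); last exact: phi_continuous.
  have q1 : p.1 + c @[p --> q] --> q.1 + c.
    by apply: cvgD; [exact: cvg_fst|exact: cvg_cst].
  exact: (cvg_pair q1 cvg_snd).
have : \forall p \near m, `[0, T]%classic `<=`
    (fun s => `|H (s, m) - H (s, p)| <= e).
  apply: (compact_near_coveringP _).1 (@segment_compact R 0 T) _ _ _ _ _.
  move=> s _; have /cvgrPdist_le/(_ (e / 2)) := Hcont (s, m).
  rewrite divr_gt0// => /(_ isT)[[A B] /= [sA mB] AB].
  exists (A, B) => //= -[s' p] /= [As' Bp].
  rewrite -(subrKA (H (s, m))) [e]splitr (le_trans (ler_normD _ _))// lerD//.
    by rewrite distrC; apply: (AB (s', m)); split=> //; exact: nbhs_singleton.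
  exact: (AB (s', p)).
by apply: filterS => p close s s0T; exact: close.
Qed.

Lemma synchronisation_exists : V !=set0 -> closed V ->
  exists f : M -> 'rV[R]_N,
    uniform_V_generalised_synchronisation F phi omega V f.
Proof.
move=> [r Vr] Vclosed.
have /choice[sol solP] : forall m, exists x,
    solution F (drive phi omega m) x /\ x 0 = r.
  move=> m; apply: (global_solution_exists K0 FK).
    exact: drive_continuous.
  exact: (Vinv m).1.
have Vsol m t : 0 <= t -> V (sol m t).
  by move=> t0; apply: (Vinv m).2 (solP m).1 _ _ t0; rewrite (solP m).2.
(* The state now, at base point [m], of the trajectory that left r at time -n. *)
pose a (n : nat) m := sol (phi (- n%:R) m) n%:R.
(* Here [n] is a point of M. After time k, [sol n] is still in V and is driven by [m], so
   contraction against [x] acts for the remaining time t. *)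
have pullback n k t m x :
    0 <= t -> solution F (drive phi omega m) x -> V (x 0) -> 0 <= k ->
    phi k n = m -> enorm (sol n (t + k) - x t) <= rate t.
  move=> t0 xsol Vx k0 nm.
  have := solution_shift k (solP n).1; rewrite nm => nsol.
  apply: (solutions_contract nsol xsol) => //.
  by rewrite add0r; exact: Vsol.
have rate_seq : rate n%:R @[n --> \oo] --> (0 : R).
  exact: (cvg_comp (fun n => n%:R) rate cvgr_idn rate_cvg0).
have acauchy m n k : `|a (n + k)%N m - a n m| <= rate n%:R.
  rewrite (le_trans (norm_le_enorm _))// /a natrD.
  apply: (pullback _ _ _ (phi (- n%:R) m)) => //; first exact: (solP _).1.
    by rewrite (solP _).2.
  by rewrite -phi_group; congr phi; ring.
have /choice[f fP] : forall m, exists l : 'rV[R]_N, a n m @[n --> \oo] --> l /\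
    forall n, `|l - a n m| <= rate n%:R.
  by move=> m; exact: geometric_cauchy_rV rate_seq (acauchy m).
exists f; split=> [m|m|].
- apply: continuous_at_approx => e e0.
  have /cvgrPdist_le/(_ _ e0)[n _ /(_ n (leqnn n))] := rate_seq.
  rewrite sub0r normrN => /(le_trans (ler_norm _)) en.
  exists (a n); last by near=> p; exact: le_trans ((fP p).2 n) en.
  apply/cvgrPdist_le => e' e'0.
  pose b := N%:R * (D * K) / delta.
  have b0 : 0 <= b by rewrite divr_ge0 ?(ltW delta0)// mulr_ge0// mulr_ge0// ltW.
  (* Both trajectories start at r, so their squared distance is at most [b * eps], which is below
     e'^2; the 1 covers b = 0. *)
  pose eps := e' ^+ 2 / (b + 1).
  have eps0 : 0 < eps by rewrite divr_gt0 ?exprn_gt0// ltr_wpDl.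
  have close := near_drive_close (- n%:R) n%:R m eps0.
  near=> p.
  have closep := near close p.
  have := solutions_close Fdiff Vconvex DxF K0 D0 delta0 FK VD (ltW eps0)
    (ler0n R n) (solP (phi (- n%:R) m)).1 (solP (phi (- n%:R) p)).1.
  rewrite !(solP _).2 subrr dotv0l mulr0 add0r -enorm_sqr => h.
  rewrite (le_trans (norm_le_enorm _))// -(ler_pXn2r (n := 2))//= ?nnegrE
    ?sqrtr_ge0//; last exact: ltW.
  apply: le_trans (h _) _ => [s|].
    move=> s0n; have := s0n; rewrite in_itv/= => /andP[s0 _].
    split; [exact: Vsol|exact: Vsol| |].
      by exists (phi s (phi (- n%:R) m)).
    exact: closep.
  have -> : N%:R * (D * (K * eps)) / delta = b * eps.
    by rewrite /b; field; rewrite gt_eqF.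
  rewrite /eps mulrCA ler_piMr ?exprn_ge0 ?ltW//.
  by rewrite ltr_pdivrMr ?mul1r ?ltrDl// ltr_wpDl.
- have Va : \forall n \near \oo, V (a n m) by apply: nearW => n; exact: Vsol.
  exact: (closed_cvg _ Vclosed Va _ (fP m).1).
(* The limit is controlled in the sup norm, and the return to the Euclidean norm costs N; the 1
   keeps [psi] positive when N = 0. *)
- pose psi t := (N%:R + 1) * rate t.
  exists psi; split=> [t||m x xsol Vx t t0].
  + by rewrite mulr_gt0 ?rate_gt0// ltr_wpDl.
  + by rewrite -(mulr0 (N%:R + 1)); apply: cvgMr; exact: rate_cvg0.
  + rewrite (le_trans (enorm_le _))// ler_pM ?ler0n ?lerDl//.
    have h : `|a n (phi t m) - x t| @[n --> \oo] --> `|f (phi t m) - x t|.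
      by apply: cvg_norm; apply: cvgB; [exact: (fP _).1|exact: cvg_cst].
    apply: (cvgr_to_le h); near=> n.
    rewrite (le_trans (norm_le_enorm _))// /a.
    (* For n >= t, the time n splits into n - t, which carries the pulled-back base point to [m],
       and t, during which the contraction acts. *)
    rewrite -{2}(subrK t n%:R) [_ - _ + _]addrC.
    apply: (pullback _ _ _ m) => //.
      by rewrite subr_ge0; near: n; exact: nbhs_infty_ger.
    by rewrite -!phi_group -[RHS]phi_id; congr phi; ring.
Unshelve. all: by end_near. Qed.

End Synchronisation.

(** * Application to the reservoir system *)

Unset Implicit Arguments.

Theorem theorem2p9 (R : realType) (n N d : nat) (M : topologicalType)
    (S : smooth_manifold R n M) (X : smooth_vector_field S)
    (phi : R -> M -> M) (hphi : evolution_operators X phi)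
    (omega : M -> 'rV[R]_d) (homega : continuous omega)
    (F : 'rV[R]_N * 'rV[R]_d -> 'rV[R]_N)
    (hF1 : Ck_on 1 setT F) (hFlip : [lipschitz F p | p in setT])
    (V : set 'rV[R]_N) (hVbounded : bounded_set V) (hVconvex : convex_set V)
    (hVinv : forall m, V_invariant F V (drive phi omega m))
    (hDx : exists2 delta : R, 0 < delta &
      forall w v z, V w -> chord V v -> range omega z ->
        dotv v (Dx F w z v) / enorm v ^+ 2 < - delta) :
  uniformly_V_asymptotically_stable F phi omega V /\
  (V !=set0 -> closed V ->
    exists f : M -> 'rV[R]_N,
      uniform_V_generalised_synchronisation F phi omega V f).
Proof.
have Fdiff p : differentiable F p by exact: hF1.1.
have [K K0 FK] := pinfty_ex_gt0 hFlip.
have {}FK p q : `|F p - F q| <= K * `|p - q| by exact: (FK (p, q)).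
have [B B0 VB] := pinfty_ex_gt0 hVbounded.
have VD x y : V x -> V y -> `|x - y| <= B + B.
  by move=> Vx Vy; rewrite (le_trans (ler_normB _ _))// lerD//; exact: VB.
have BB0 : 0 <= B + B by rewrite addr_ge0// ltW.
have [delta delta0 DxF] := hDx.
have phi_group t1 t2 m : phi (t1 + t2) m = phi t1 (phi t2 m).
  by rewrite (evolution_group hphi).
(* The group law makes [phi 0] idempotent, and an injective idempotent map is the identity. *)
have phi_id m : phi 0 m = m.
  have [h [phiK _ _ _]] := evolution_diffeo hphi 0.
  by rewrite -[LHS]phiK -phi_group addr0 phiK.
split.
  exact: (asymptotic_stability delta0 K0 BB0 Fdiff FK VD hVconvex hVinv DxF).
exact: (synchronisation_exists phi_id phi_group (evolution_continuous hphi)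
  homega delta0 K0 BB0 Fdiff FK VD hVconvex hVinv DxF).
Qed.
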